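(* Let $G$ be a (finite, simple) plane graph with minimum degree five that contains no $\langle 5,5,5,5,\infty\rangle$-star, no vertex of degree $6$ and no vertex of degree $7$. Then $G$ has a minor $5$-star of weight at most $44$ and height at most $15$.
   Context: A plane graph is a graph embedded in the plane without edge crossings; $\deg(v)$ denotes the degree of $v$ in $G$. For integers (or $\infty$) $\kappa_1,\dots,\kappa_5$, a $\langle \kappa_1,\kappa_2,\kappa_3,\kappa_4,\kappa_5\rangle$-star in $G$ is a vertex $v$ of degree exactly $5$ together with its five neighbors $v_1,\dots,v_5$, listed in the cyclic order around $v$ given by the embedding (starting at some neighbor, in either orientation), such that $\deg(v_i)\le \kappa_i$ for $i=1,\dots,5$; the entry $\infty$ means no restriction. A minor $5$-star is a $5$-vertex together with its five neighbors. The weight of a subgraph $H$ is $\sum_{v\in V(H)}\deg_G(v)$, and its height is $\max_{v\in V(H)}\deg_G(v)$. *)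

(* Defs.v *)
From mathcomp Require Export all_boot all_fingroup.

Set Implicit Arguments.
Unset Strict Implicit.
Unset Printing Implicit Defensive.

Record sgraph := SGraph {
  vertex :> finType;
  adj : rel vertex;
  adj_sym : symmetric adj;
  adj_irr : irreflexive adj
}.

Definition nbh (G : sgraph) (v : G) : {set G} := [set u | adj v u].

Definition deg (G : sgraph) (v : G) : nat := #|nbh v|.

Definition min_degree (G : sgraph) (k : nat) : Prop :=
  (forall v : G, k <= deg v) /\ (exists v : G, deg v = k).

(** A dart [(u, v)] is the edge [uv] directed from [u] to [v]. *)
Definition dart (G : sgraph) : finType := {d : G * G | adj d.1 d.2}.

Definition source (G : sgraph) (d : dart G) : G := (val d).1.

Definition target (G : sgraph) (d : dart G) : G := (val d).2.

Lemma flip_subproof (G : sgraph) (d : dart G) : adj (target d) (source d).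
Proof. by rewrite adj_sym; apply: (valP d). Qed.

Definition flip (G : sgraph) (d : dart G) : dart G :=
  exist _ (target d, source d) (flip_subproof d).

(** An embedding in an oriented surface, given by its rotation system: [s]
    permutes cyclically the darts leaving each vertex. *)
Definition rotation_system (G : sgraph) (s : {perm dart G}) : Prop :=
  forall d d' : dart G, fconnect s d d' = (source d == source d').

(** Successor of [d] along the boundary of a face. *)
Definition face_next (G : sgraph) (s : {perm dart G}) (d : dart G) : dart G :=
  s (flip d).

Definition dart_link (G : sgraph) (s : {perm dart G}) : rel (dart G) :=
  [rel d d' | (flip d == d') || (s d == d')].

(** Genus zero, i.e. Euler's formula in its dart form
    [V + E + F = #darts + 2 C], where [#darts = 2 E].  The graph need not be
    connected: [F] counts the faces of the [C] components embedded separately,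
    and as every component has nonnegative genus the equality says that each of
    them is embedded in the sphere.  Isolated vertices carry no dart and do not
    contribute to either side. *)
Definition genus0 (G : sgraph) (s : {perm dart G}) : Prop :=
  fcard s (dart G) + fcard (@flip G) (dart G) + fcard (face_next s) (dart G)
  = #|dart G| + (n_comp (dart_link s) (dart G)).*2.

Record plane_graph := PlaneGraph {
  pgraph :> sgraph;
  rotation : {perm dart pgraph};
  rotationP : rotation_system rotation;
  rotation_genus0 : genus0 rotation
}.

(** [vs] lists the neighbors of the 5-vertex [v] in the cyclic order given by
    the embedding, from some neighbor on, in one of the two orientations. *)
Definition cyclic_listing5 (G : plane_graph) (v : G) (vs : seq G) : Prop :=
  deg v = 5 /\
  exists2 d : dart G, source d = v &
    vs = [seq target x | x <- traject (rotation G) d 5] \/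
    vs = [seq target x | x <- traject (rotation G)^-1%g d 5].

(** [None] stands for the bound infinity. *)
Definition le_bound (n : nat) (k : option nat) : bool :=
  if k is Some m then n <= m else true.

Definition is_star (G : plane_graph) (k1 k2 k3 k4 k5 : option nat)
    (v v1 v2 v3 v4 v5 : G) : Prop :=
  cyclic_listing5 v [:: v1; v2; v3; v4; v5] /\
  [/\ le_bound (deg v1) k1, le_bound (deg v2) k2, le_bound (deg v3) k3,
      le_bound (deg v4) k4 & le_bound (deg v5) k5].

Definition has_star (G : plane_graph) (k1 k2 k3 k4 k5 : option nat) : Prop :=
  exists v v1 v2 v3 v4 v5 : G, is_star k1 k2 k3 k4 k5 v v1 v2 v3 v4 v5.

(** The vertex sets of the minor 5-stars; weight and height only depend
    on the vertex set. *)
Definition minor5_star (G : sgraph) (H : {set G}) : Prop :=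
  exists2 v : G, deg v = 5 & H = v |: nbh v.

Definition weight (G : sgraph) (H : {set G}) : nat := \sum_(v in H) deg v.

Definition height (G : sgraph) (H : {set G}) : nat := \max_(v in H) deg v.

(* Main.v *)
Require Import Defs.
From mathcomp Require Import zify.

(** Discharging, with charges scaled by 40.  In the dart form of Euler's formula a
    vertex [v] has charge [40 deg v - 240] and a face [f] has [80 |f| - 240], and
    the total is negative.  If no minor 5-star is light, every charge can be made
    nonnegative as follows.
    - A vertex of degree [n >= 8] reserves [share n] for each of its neighbors,
      with [n * share n <= 40 n - 240]; 5-neighbors receive it.  This pays the
      deficit 40 of every 5-vertex [v] except when [v] has exactly two neighbors
      of degree at least 8, namely [u] of degree 8 or 9 and [W] of degree at least
      16.  Then [v] gets only 35.
    - The share reserved for a neighbor of degree at least 8 is free: a vertex of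
      degree at least 16 passes 5 of it to the neighbors next to the free one in
      the rotation, and a vertex of degree 8 or 9 to those two steps away.  The
      former pays [v] when [u] and [W] are consecutive around [v].
    - A face of length at least 4 gives 10 to each of its corners and 10 across
      each of its edges to the opposite vertex of the adjacent triangle.
    - In the remaining case the neighbors of [v] are [u, p, W, q, r] in cyclic
      order and all faces around are triangles.  Let [x], [z] be the other two
      neighbors of [r], with [z] adjacent to [u].  If [deg z >= 8] then [u] passes
      5 to [v].  Otherwise the star of [r] forces [deg x >= 16], so [q] gets at
      least 50 from [W] and [x] and relays 5 to each of [v] and [r]. *)

Set Implicit Arguments.
Unset Strict Implicit.
Unset Printing Implicit Defensive.

(** Each cycle of [f] is counted at its root, so the inequalities of the single cycles add up. It
    serves vertices, edges and faces alike, as cycles of [s], [flip] and [phi]. *)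
Lemma sum_fcard (T : finType) (f : T -> T) (k : nat) (b c : T -> nat) :
    injective f ->
    (forall x, k + \sum_(y | fconnect f x y) b y <=
               \sum_(y | fconnect f x y) c y) ->
  k * fcard f T + \sum_y b y <= \sum_y c y.
Proof.
move=> injf le_bc; have symf := fconnect_sym injf.
have split_sum (F : T -> nat) :
    \sum_y F y = \sum_(r | r \in froots f) \sum_(y | fconnect f r y) F y.
  rewrite (partition_big (froot f) (mem (froots f))) /=; last first.
    by move=> y _; apply: roots_root.
  apply: eq_bigr => r /eqP rootr; apply: eq_bigl => y.
  by rewrite -(root_connect symf) rootr eq_sym.
rewrite !split_sum /n_comp_mem -sum1_card big_distrr /=.
rewrite [X in X + _ <= _](eq_bigl (mem (froots f))); last first.
  by move=> r; rewrite !inE andbT.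
by rewrite -big_split /=; apply: leq_sum => r _; rewrite muln1.
Qed.

(** * Darts and their reversal *)

Section Darts.

Variable G : sgraph.
Implicit Types d e : dart G.

Lemma dart_inj d e : source d = source e -> target d = target e -> d = e.
Proof.
case: d e => [[a b] /= p] [[c d] /= q]; rewrite /source /target /= => eac ebd.
by apply: val_inj; rewrite /= eac ebd.
Qed.

Lemma source_flip d : source (flip d) = target d. Proof. by []. Qed.

Lemma target_flip d : target (flip d) = source d. Proof. by []. Qed.

Lemma flipK : involutive (@flip G).
Proof. by move=> d; apply: dart_inj. Qed.

Lemma flip_inj : injective (@flip G).
Proof. exact: inv_inj flipK. Qed.

Lemma target_neq_source d : target d != source d.
Proof.
apply/eqP => eq_st; have := valP d; rewrite /= -/(source d) -/(target d).
by rewrite eq_st adj_irr.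
Qed.

Lemma flip_neq d : flip d != d.
Proof.
by apply: contra_neq (target_neq_source d) => eqd; rewrite -source_flip eqd.
Qed.

Lemma double_fcard_flip : 2 * fcard (@flip G) (dart G) <= #|dart G|.
Proof.
have := @sum_fcard _ (@flip G) 2 (fun=> 0) (fun=> 1) flip_inj.
rewrite sum1_card big1 // addn0; apply=> x; rewrite big1 // addn0.
rewrite (bigD1 x) ?connect0 //= (bigD1 (flip x)) ?fconnect1 ?flip_neq //=.
Qed.

Lemma sum_darts_at (v : G) (F : G -> nat) :
  \sum_(d : dart G | source d == v) F (target d) = \sum_(u in nbh v) F u.
Proof.
rewrite (partition_big (@target G) (mem (nbh v))) /=; last first.
  by move=> d /eqP <-; rewrite inE; apply: (valP d).
apply: eq_bigr => u; rewrite inE => adj_vu.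
pose d0 : dart G := exist _ (v, u) adj_vu.
rewrite (bigD1 d0) /= ?eqxx // big1 ?addn0 // => d.
case/andP=> /andP[/eqP sd /eqP td] /eqP[]; exact: dart_inj.
Qed.

End Darts.

(** * Rotations, triangles and face lengths *)

Section Rotation.

Variable G : plane_graph.
Implicit Types d e x : dart G.

Local Notation s := (rotation G).
Local Notation t := ((rotation G)^-1)%g.
Local Notation phi := (face_next (rotation G)).

Lemma source_rot d : source (s d) = source d.
Proof. by apply/esym/eqP; rewrite -(rotationP d (s d)) fconnect1. Qed.

Lemma source_rotV d : source (t d) = source d.
Proof. by rewrite -[in RHS](permKV s d) source_rot. Qed.

Lemma order_rot d : fingraph.order s d = deg (source d).
Proof.
rewrite /fingraph.order /deg -!sum1_card -(sum_darts_at (source d) (fun=> 1)).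
by apply: eq_bigl => y; rewrite [y \in _](rotationP d y) eq_sym.
Qed.

Lemma sum_rotation5 x (F : dart G -> nat) : deg (source x) = 5 ->
  \sum_(y | fconnect s x y) F y =
  F x + F (s x) + F (s (s x)) + F (s (s (s x))) + F (s (s (s (s x)))).
Proof.
move=> deg5; rewrite (eq_bigl (mem (fingraph.orbit s x))); last first.
  by move=> y; rewrite fconnect_orbit.
rewrite -big_uniq ?orbit_uniq // /fingraph.orbit order_rot deg5 /=.
by rewrite !big_cons big_nil addn0 !addnA.
Qed.

Lemma iter5_rot x : deg (source x) = 5 -> s (s (s (s (s x)))) = x.
Proof. by move=> deg5; have := iter_order (@perm_inj _ s) x; rewrite order_rot deg5. Qed.

Lemma face_inj : injective phi.
Proof. by move=> d e /perm_inj /flip_inj. Qed.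

Lemma source_face d : source (phi d) = target d.
Proof. exact: source_rot. Qed.

Definition tri d := phi (phi (phi d)) == d.

Lemma tri_face d : tri (phi d) = tri d.
Proof. by rewrite /tri (inj_eq face_inj). Qed.

Definition flat d := tri d && tri (flip d).

Lemma flat_flip d : flat (flip d) = flat d.
Proof. by rewrite /flat flipK andbC. Qed.

(** Unfolding [phi (phi (phi d)) = d] expresses a turn at the far end of [d] by turns at the other
    corners of the triangle. *)
Lemma flat_rot d : flat d -> s (flip d) = flip (t (flip (t d))).
Proof.
case/andP=> /eqP tri_d _; apply: (canRL (@flipK G)).
apply: (canRL (permK s)); apply: (canRL (@flipK G)).
by apply: (canRL (permK s)).
Qed.

Lemma flat_rotV d : flat d -> t (flip d) = flip (s (flip (s d))).
Proof.
case/andP=> _ /eqP tri_d; rewrite -{1}tri_d permK.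
by rewrite /face_next flipK.
Qed.

Lemma target_flat_rot d : flat d -> target (s (flip d)) = target (t d).
Proof. by move/flat_rot->; rewrite target_flip source_rotV. Qed.

Lemma target_flat_rotV d : flat d -> target (t (flip d)) = target (s d).
Proof. by move/flat_rotV->; rewrite target_flip source_rot. Qed.

Hypothesis deg_ge5 : forall v : G, 5 <= deg v.

(** A face of length 1 would be a loop; one of length 2 would make [s] fix a dart, giving a vertex
    of degree 1. *)
Lemma order_face d : 3 <= fingraph.order phi d.
Proof.
have neq1 e : phi e != e.
  apply: contra_neq (target_neq_source e) => eq_e.
  by rewrite -source_face eq_e.
have neq2 e : phi (phi e) != e.
  apply/eqP => eq_e; have eq_flip : phi e = flip e.
    by apply: dart_inj; rewrite ?source_face // -source_face eq_e.
  have fix_e : s (flip e) = flip e by [].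
  have := deg_ge5 (source (flip e)); rewrite -order_rot.
  have := @order_le_cycle _ s [:: flip e]; rewrite /= fix_e eqxx.
  by move=> /(_ isT (flip e) (mem_head _ _)); lia.
rewrite /fingraph.order (cardD1 d) (cardD1 (phi d)) (cardD1 (phi (phi d))).
rewrite !inE !neq1 neq2 connect0 fconnect1 /= (fconnect_iter phi 2).
by [].
Qed.

(** A face that is not a triangle has length at least 4, so 60 per dart still reaches 240; the other
    20 are its two payments of 10. *)
Lemma face_weight :
  240 * fcard phi (dart G) <= \sum_(d : dart G) (if tri d then 80 else 60).
Proof.
have := @sum_fcard _ phi 240 (fun=> 0) (fun d => if tri d then 80 else 60).
rewrite big1 // addn0; apply=> [|x]; first exact: face_inj.
rewrite big1 // addn0.
have tri_const y : fconnect phi x y -> tri y = tri x.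
  by move=> cxy; apply/esym/(fconnect_invariant _ cxy) => z /=; rewrite tri_face eqxx.
rewrite (eq_bigr (fun=> if tri x then 80 else 60)); last first.
  by move=> y /tri_const ->.
rewrite sum_nat_const -/(fingraph.order phi x); have := order_face x.
case: (boolP (tri x)) => [_|ntri]; first by lia.
rewrite leq_eqVlt => /predU1P[eq3|]; last by lia.
case/negP: ntri; apply/eqP.
by have := iter_order face_inj x; rewrite -eq3.
Qed.

End Rotation.

(** * Arithmetic of the shares *)

(** From 8 to 15 this is [(40 n - 240) / n] rounded down, lowered further at 9 and 13. The default
    25 covers every degree from 16 on. *)
Definition share (n : nat) : nat :=
  nth 25 [:: 0; 0; 0; 0; 0; 0; 0; 0; 10; 10; 16; 18; 20; 20; 22; 24] n.

Lemma share_ge n :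
  [/\ 8 <= n -> 10 <= share n, 10 <= n -> 16 <= share n,
      11 <= n -> 18 <= share n & 12 <= n -> 20 <= share n] /\
  [/\ 14 <= n -> 22 <= share n, 15 <= n -> 24 <= share n &
      16 <= n -> share n = 25].
Proof.
by do 16 (case: n => [|n]; first by []); rewrite /share /= nth_nil.
Qed.

Lemma share_afford n : 8 <= n -> 240 + n * share n <= n * 40.
Proof.
do 16 (case: n => [|n]; first by []).
by rewrite /share /= nth_nil; lia.
Qed.

(* The degrees around a 5-vertex of a graph without the required star. *)
Definition heavy5 (a0 a1 a2 a3 a4 : nat) : Prop :=
  [/\ [/\ a0 = 5 \/ 8 <= a0, a1 = 5 \/ 8 <= a1, a2 = 5 \/ 8 <= a2,
          a3 = 5 \/ 8 <= a3 & a4 = 5 \/ 8 <= a4],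
      2 <= (8 <= a0) + (8 <= a1) + (8 <= a2) + (8 <= a3) + (8 <= a4) &
      40 <= a0 + a1 + a2 + a3 + a4 \/
      16 <= a0 \/ 16 <= a1 \/ 16 <= a2 \/ 16 <= a3 \/ 16 <= a4].

(* The only pattern for which the shares of the neighbors fall short of the
   deficit [40], by [5]. *)
Definition short5 (a0 a1 a2 a3 a4 : nat) : bool :=
  (8 <= a0 <= 9) &&
  [|| [&& 16 <= a1, a2 == 5, a3 == 5 & a4 == 5],
      [&& a1 == 5, 16 <= a2, a3 == 5 & a4 == 5],
      [&& a1 == 5, a2 == 5, 16 <= a3 & a4 == 5] |
      [&& a1 == 5, a2 == 5, a3 == 5 & 16 <= a4]].

(** A weight above 44 with three more neighbors of degree 5 forces [25 <= a + b]. If the smaller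
    degree is 10, 11 or at least 12, the shares reach 16 + 24, 18 + 22 or 20 + 20. *)
Lemma share2 a b : 8 <= a -> 8 <= b -> 25 <= a + b \/ 16 <= a \/ 16 <= b ->
    share a + share b < 40 ->
  (a <= 9) && (16 <= b) || (b <= 9) && (16 <= a).
Proof.
wlog le_ab : a b / a <= b => [IH a8 b8 hab lt40|].
  by case/orP: (leq_total a b) => le_ab; [|rewrite orbC]; apply: IH => //; lia.
move=> a8 _ hab lt40; apply/orP; left; move: lt40.
have {}hab : 25 <= a + b \/ 16 <= b by lia.
case: (share_ge a) (share_ge b) => [[_ a10 a11 a12] _] [[_ _ _ b12] [b14 b15 b16]].
case: (leqP 12 a) => [le12|lt12]; first by have := b12 (leq_trans le12 le_ab); lia.
case: (leqP 11 a) => [le11|lt11].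
  by have := b14; have := a11 le11; lia.
case: (leqP 10 a) => [le10|lt10].
  by have := b15; have := a10 le10; lia.
lia.
Qed.

Lemma share3 a b c : 8 <= a -> 8 <= b -> 8 <= c ->
    30 <= a + b + c \/ 16 <= a \/ 16 <= b \/ 16 <= c ->
  40 <= share a + share b + share c.
Proof.
(* This line passes through the values 10 at 9 and 20 at 12. Three degrees below 12 with sum at
   least 30 then yield 40; a degree of at least 12 yields 20 + 10 + 10. *)
have linear n : 8 <= n <= 12 -> 10 * n <= 3 * share n + 60.
  by do 13 (case: n => [|n]; first by []).
move=> a8 b8 c8 habc.
move: (linear a) (linear b) (linear c) => la lb lc.
move: (share_ge a) (share_ge b) (share_ge c).
move=> [[a10 _ _ a20] _] [[b10 _ _ b20] _] [[c10 _ _ c20] _].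
move: (a10 a8) (b10 b8) (c10 c8) => {}a10 {}b10 {}c10.
case: (leqP 12 a) => ha; first by move: (a20 ha); lia.
case: (leqP 12 b) => hb; first by move: (b20 hb); lia.
case: (leqP 12 c) => hc; first by move: (c20 hc); lia.
by move: la lb lc; rewrite a8 b8 c8 (ltnW ha) (ltnW hb) (ltnW hc); lia.
Qed.

(** Four neighbors of degree at least 8 already pay 10 each, three are settled by [share3], and two
    leave only the exception of [share2]. *)
Lemma heavy5_cases a0 a1 a2 a3 a4 : heavy5 a0 a1 a2 a3 a4 ->
    share a0 + share a1 + share a2 + share a3 + share a4 < 40 ->
  [|| short5 a0 a1 a2 a3 a4, short5 a1 a2 a3 a4 a0, short5 a2 a3 a4 a0 a1,
      short5 a3 a4 a0 a1 a2 | short5 a4 a0 a1 a2 a3].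
Proof.
case=> [[h0 h1 h2 h3 h4] hcount hsum] lt40.
have ten n : 8 <= n -> 10 <= share n by case: (share_ge n) => [[]].
have share5 : share 5 = 0 by [].
case: h0 => h0; case: h1 => h1; case: h2 => h2; case: h3 => h3; case: h4 => h4;
  subst; rewrite ?share5 ?add0n ?addn0 in lt40; move: hcount;
  rewrite /= ?h0 ?h1 ?h2 ?h3 ?h4 // => _;
  lazymatch goal with
  | H1 : is_true (8 <= ?a), H2 : is_true (8 <= ?b), H3 : is_true (8 <= ?c),
    H4 : is_true (8 <= ?d) |- _ =>
    exfalso; clear hsum; move: (ten _ H1) (ten _ H2) (ten _ H3) (ten _ H4); lia
  | H1 : is_true (8 <= ?a), H2 : is_true (8 <= ?b), H3 : is_true (8 <= ?c) |- _ =>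
    exfalso; have := share3 H1 H2 H3; lia
  | H1 : is_true (8 <= ?a), H2 : is_true (8 <= ?b) |- _ =>
    case/orP: (share2 H1 H2 ltac:(lia) ltac:(lia)) => /andP[hl hr];
      rewrite /short5 hl hr ?H1 ?H2 ?eqxx ?orbT //
  end.
Qed.

Lemma short5_share a0 a1 a2 a3 a4 : short5 a0 a1 a2 a3 a4 ->
  35 <= share a0 + share a1 + share a2 + share a3 + share a4.
Proof.
have ten n : 8 <= n -> 10 <= share n by case: (share_ge n) => [[]].
have big n : 16 <= n -> share n = 25 by case: (share_ge n) => _ [].
case/andP=> /andP[/ten le10 _] /or4P[] /and4P[h1 h2 h3 h4];
  by move: (big a1) (big a2) (big a3) (big a4); rewrite ?h1 ?h2 ?h3 ?h4; lia.
Qed.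

Lemma heavy5_share a0 a1 a2 a3 a4 : heavy5 a0 a1 a2 a3 a4 ->
  35 <= share a0 + share a1 + share a2 + share a3 + share a4.
Proof.
move=> /heavy5_cases; case: ltnP => [_ /(_ isT)|le40 _]; last by lia.
by case/orP=> [|/or4P[]] /short5_share; lia.
Qed.

(** * Discharging rules and final charges of vertices *)

Section Discharging.

Variable G : plane_graph.
Implicit Types d e x y : dart G.

Local Notation s := (rotation G).
Local Notation t := ((rotation G)^-1)%g.
Local Notation phi := (face_next (rotation G)).

Definition tdeg d := deg (target d).

Definition give d := if tdeg d == 5 then share (deg (source d)) else 0.

(* The free share of the dart [d], to the ends of [s^2 d] and [s^-2 d]. *)
Definition pass_far d :=
  if (8 <= deg (source d) <= 9) && (8 <= tdeg d) then 5 else 0.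

(* The free share of the dart [d], to the ends of [s d] and [s^-1 d]. *)
Definition pass_near d :=
  if (16 <= deg (source d)) && (8 <= tdeg d) then 5 else 0.

(* In the notation of the header, [d] goes from [q] to [v], and the darts [r d],
   [r' d], [r' (r' d)] end at [W], [r], [x]. *)
Definition relay (r r' : dart G -> dart G) d :=
  if [&& deg (source d) == 5, tdeg d == 5, 16 <= tdeg (r d), tdeg (r' d) == 5
       & 16 <= tdeg (r' (r' d))] then 5 else 0.

Definition spill d := if tri d then 0 else 10.

Definition outgoing d :=
  give d + (pass_far d + pass_far d) + (pass_near d + pass_near d) +
  (relay s t d + relay t s d).

(** Indexed by the receiver [source e]: what [target e] passes or relays to it, the payment at its
    corner on the face of [e], and the one across the edge of [phi e], which is opposite to it in a
    triangle. *)
Definition bonus e :=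
  (pass_far (s (s (flip e))) + pass_far (t (t (flip e)))) +
  (pass_near (s (flip e)) + pass_near (t (flip e))) +
  (relay s t (flip e) + relay t s (flip e)) +
  (spill e + spill (flip (phi e))).

Definition incoming e := give (flip e) + bonus e.

(** Every rule moves charge along a bijection of the darts. The spills are left over because faces,
    not vertices, pay them. *)
Lemma sum_incoming :
  \sum_e incoming e = \sum_d outgoing d + 2 * \sum_d spill d.
Proof.
have re (h : dart G -> dart G) (F : dart G -> nat) :
    injective h -> \sum_e F (h e) = \sum_d F d.
  by move=> injh; rewrite [RHS](reindex_inj injh).
have split_sum (F H : dart G -> nat) :
    \sum_e (F e + H e) = \sum_e F e + \sum_e H e by rewrite big_split.
have sfI : injective (fun e => s (flip e)) by apply: inj_comp perm_inj (@flip_inj G).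
have tfI : injective (fun e => t (flip e)) by apply: inj_comp perm_inj (@flip_inj G).
have ssfI : injective (fun e => s (s (flip e))) by apply: inj_comp perm_inj sfI.
have ttfI : injective (fun e => t (t (flip e))) by apply: inj_comp perm_inj tfI.
have fpI : injective (fun e => flip (phi e)) by apply: inj_comp (@flip_inj G) sfI.
rewrite /incoming /bonus /outgoing !split_sum.
rewrite !(re _ _ ssfI) !(re _ _ ttfI) !(re _ _ fpI) !(re _ _ sfI) !(re _ _ tfI).
rewrite !(re _ _ (@flip_inj G)); lia.
Qed.

Hypothesis heavy : forall x, deg (source x) = 5 ->
  heavy5 (tdeg x) (tdeg (s x)) (tdeg (s (s x))) (tdeg (s (s (s x))))
         (tdeg (s (s (s (s x))))).

(* [r] is the rotation or its inverse, so that one proof covers both mirror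
   images; [h] below goes from the vertex [r] of the header to [u]. *)
Lemma spread_opposite (r r' : dart G -> dart G) x :
    cancel r r' -> cancel r' r -> (forall d, source (r d) = source d) ->
    (forall d, flat d -> target (r (flip d)) = target (r' d)) ->
    (forall d, flat d -> target (r' (flip d)) = target (r d)) ->
    (forall y, deg (source y) = 5 -> r (r (r (r (r y)))) = y) ->
    (forall y, deg (source y) = 5 ->
      heavy5 (tdeg y) (tdeg (r y)) (tdeg (r (r y))) (tdeg (r (r (r y))))
             (tdeg (r (r (r (r y)))))) ->
    deg (source x) = 5 ->
    (forall e, source e = source x ->
      [/\ flat e, flat (r (flip e)) & flat (r' (flip e))]) ->
    8 <= tdeg x <= 9 -> 16 <= tdeg (r (r x)) ->
    tdeg (r (r (r x))) = 5 -> tdeg (r (r (r (r x)))) = 5 ->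
  (5 <= pass_far (r (r (flip x)))) || (5 <= relay r r' (flip (r (r (r x))))).
Proof.
move=> rK r'K source_r flat_r flat_r' r5 heavy_r deg_x flat_x deg_u deg_W deg_q.
have source_r' d : source (r' d) = source d by rewrite -[in RHS](r'K d) source_r.
have r4 y : deg (source y) = 5 -> r (r (r (r y))) = r' y.
  by move=> /r5 eq5; rewrite -{2}eq5 rK.
rewrite r4 // => deg_r.
have r3 : r (r (r x)) = r' (r' x) by rewrite -(r4 x deg_x) rK.
rewrite r3 in deg_q *.
have sx := (source_r, source_r', source_flip, target_flip).
have [flat0 flat1 _] := flat_x x erefl.
have [] := flat_x (r' x); rewrite ?sx // => flat4 flat4' _.
have [] := flat_x (r' (r' x)); rewrite ?sx // => flat3 _ _.
set h := flip (r (flip x)).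
have source_h : source h = target (r' x) by rewrite /h !sx flat_r.
have rh : r h = flip (r' x).
  apply: dart_inj; first by rewrite source_r source_h.
  by rewrite flat_r // rK !target_flip source_r'.
have deg_h : deg (source h) = 5 by rewrite source_h.
have tdeg_h : tdeg h = tdeg x by rewrite /tdeg /h !sx.
have tdeg_h1 : tdeg (r h) = 5 by rewrite /tdeg rh !sx.
have tdeg_h2 : tdeg (r (r h)) = 5 by rewrite rh /tdeg flat_r.
have tdeg_h4 : tdeg (r' h) = tdeg (r (r (flip x))).
  by rewrite /tdeg /h flat_r'.
(* In the notation of the header, both sides are the dart from [q] to the vertex [r], reached
   through the triangles on the edge [vq] and on the edge [vr]. *)
have r'j : r' (flip (r' (r' x))) = flip (r (r h)).
  apply: dart_inj; first by rewrite !sx rh flat_r.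
  by rewrite flat_r' // r'K target_flip !source_r source_h.
have tdeg_far : tdeg (r' (r' (flip (r' (r' x))))) = tdeg (r (r (r h))).
  by rewrite r'j /tdeg flat_r' // rh.
have := heavy_r h deg_h; rewrite (r4 h deg_h) tdeg_h tdeg_h1 tdeg_h2 tdeg_h4.
rewrite /pass_far /relay !sx -/(tdeg x) deg_u /=.
case: (leqP 8 (tdeg (r (r (flip x))))) => [//|small_z] [[_ _ _ _ z5] _ hsum].
rewrite -/(tdeg (r' (r' x))) deg_q eqxx {1}/tdeg target_flip !sx deg_x eqxx /=.
rewrite {1}/tdeg flat_r // -/(tdeg _) -r3 rK deg_W /=.
have -> : tdeg (r' (flip (r (r (r x))))) = 5 by rewrite r3 /tdeg flat_r' // r'K.
rewrite r3 eqxx /= tdeg_far.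
have deg_z : tdeg (r (r (flip x))) = 5 by lia.
(* Around the start of [h] the other degrees are at most 9 and three times 5, so a degree sum of 40
   leaves at least 16 here. *)
have -> : 16 <= tdeg (r (r (r h))) by move: hsum; rewrite deg_z; lia.
by [].
Qed.

Lemma outgoing_major d : 8 <= deg (source d) -> outgoing d <= share (deg (source d)).
Proof.
move=> deg8; have [[ten _ _ _] [_ _ big]] := share_ge (deg (source d)).
rewrite /outgoing /relay (gtn_eqF (leq_trans _ deg8)) //= addn0.
rewrite /give /pass_far /pass_near deg8 /=.
case: eqP => [->|_] /=; first by rewrite !andbF; lia.
case: (8 <= tdeg d); rewrite ?andbF //= !andbT.
case: (leqP (deg (source d)) 9) => le9; last by case: leqP => // /big ->.
by rewrite ifF; [apply: ten | lia].
Qed.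

(** Relaying needs two consecutive 5-neighbors flanked by degrees of at least 16. Among five
    neighbors this occurs at most once, so two relays of 5 are paid out of two shares of 25. *)
Lemma outgoing_five x : deg (source x) = 5 ->
  let total (F : dart G -> nat) := \sum_(y | fconnect s x y) F y in
  total outgoing = 0 \/
  total outgoing <= 10 /\ 50 <= total (fun y => share (tdeg y)).
Proof.
move=> deg_x total; rewrite /total !sum_rotation5 //.
have out y : deg (source y) = 5 -> outgoing y = relay s t y + relay t s y.
  move=> deg_y; rewrite /outgoing /give /pass_far /pass_near deg_y /=.
  by case: ifP.
rewrite !out ?source_rot //.
have tx : t x = s (s (s (s x))) by rewrite -{1}(iter5_rot deg_x) permK.
rewrite /relay ?source_rot deg_x eqxx /= !permK (iter5_rot deg_x) tx !permK.
set a0 := tdeg x; set a1 := tdeg (s x); set a2 := tdeg (s (s x)).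
set a3 := tdeg (s (s (s x))); set a4 := tdeg (s (s (s (s x)))).
have sh n : 16 <= n -> share n = 25 by case: (share_ge n) => _ [].
have no n : 16 <= n -> (n == 5) = false by lia.
case: (leqP 16 a0) => h0; case: (leqP 16 a1) => h1; case: (leqP 16 a2) => h2;
case: (leqP 16 a3) => h3; case: (leqP 16 a4) => h4;
  rewrite ?andbF /= ?(no _ h0) ?(no _ h1) ?(no _ h2) ?(no _ h3) ?(no _ h4) /=
    ?andbF /= ?(sh _ h0) ?(sh _ h1) ?(sh _ h2) ?(sh _ h3) ?(sh _ h4);
  try (by left); right; split; repeat case: ifP; lia.
Qed.

Lemma short5_bonus x : deg (source x) = 5 ->
    short5 (tdeg x) (tdeg (s x)) (tdeg (s (s x))) (tdeg (s (s (s x))))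
           (tdeg (s (s (s (s x))))) ->
  exists2 e, source e = source x & 5 <= bonus e.
Proof.
move=> deg_x short.
case: (boolP [exists e, (source e == source x) && (5 <= bonus e)]).
  by case/existsP=> e /andP[/eqP se be]; exists e.
move/existsPn => small.
have {}small e : source e = source x -> bonus e < 5.
  by move=> se; have := small e; rewrite se eqxx /= -ltnNge.
(* A single spill of 10 would exceed the assumed bound, so all faces at the vertex and those across
   the opposite edges are triangles. *)
have rim e : source e = source x -> flat e && flat (phi e).
  move=> /[dup] /small; rewrite /bonus /flat /spill => small_e se.
  have := small (s e) (etrans (source_rot e) se); rewrite /bonus /spill.
  have -> : tri (s e) = tri (flip e) by rewrite -(tri_face (flip e)) /face_next flipK.
  rewrite tri_face; move: small_e.
  by do 3 (case: ifP => _; try lia).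
have flats e : source e = source x ->
    [/\ flat e, flat (s (flip e)) & flat (t (flip e))].
  move=> se; have /andP[flat_e flat_rim] := rim e se; split=> //.
  rewrite flat_rotV // flat_flip.
  by have /andP[] := rim (s e) (etrans (source_rot e) se).
have t5 y : deg (source y) = 5 -> t (t (t (t (t y)))) = y.
  by move=> /iter5_rot eq5; rewrite -{1}eq5 !permK.
have tx y : deg (source y) = 5 -> t y = s (s (s (s y))).
  by move=> /iter5_rot eq5; rewrite -{1}eq5 permK.
case/andP: short => deg_u /or4P[] /and4P[].
- move=> deg_W _ _ _; exists (s x); first exact: source_rot.
  have [flat_W _ _] := flats (s x) (source_rot x).
  rewrite /bonus /pass_near source_rot source_flip deg_W /=.
  rewrite /tdeg target_flat_rot // permK -/(tdeg x).
  by case/andP: deg_u => -> _ /=; lia.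
- move=> _ deg_W /eqP deg_q /eqP deg_r.
  have := @spread_opposite s t x (permK s) (permKV s) (@source_rot G)
    (@target_flat_rot G) (@target_flat_rotV G) (@iter5_rot G) heavy deg_x flats
    deg_u deg_W deg_q deg_r.
  have := small x erefl; have := small (s (s (s x))); rewrite !source_rot.
  by move=> /(_ erefl); rewrite /bonus; lia.
- move=> /eqP deg_r /eqP deg_q deg_W _.
  have heavy_t y : deg (source y) = 5 ->
      heavy5 (tdeg y) (tdeg (t y)) (tdeg (t (t y))) (tdeg (t (t (t y))))
             (tdeg (t (t (t (t y))))).
    move=> deg_y; rewrite (tx y deg_y) !permK.
    case: (heavy deg_y) => [[? ? ? ? ?] hcount hsum]; split; [by split|lia|lia].
  have flats_t e : source e = source x ->
      [/\ flat e, flat (t (flip e)) & flat (s (flip e))].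
    by move=> /flats[].
  (* The mirror image of the previous case: read backwards, [W] is again the second neighbor after
     [u]. *)
  have := @spread_opposite t s x (permKV s) (permK s) (@source_rotV G)
    (@target_flat_rotV G) (@target_flat_rot G) t5 heavy_t deg_x flats_t deg_u.
  rewrite (tx x deg_x) !permK => /(_ deg_W deg_q deg_r).
  have := small x erefl; have := small (s (s x)); rewrite !source_rot.
  by move=> /(_ erefl); rewrite /bonus; lia.
- move=> _ _ _; rewrite -tx // => deg_W; exists (t x); first exact: source_rotV.
  have [flat_W _ _] := flats (t x) (source_rotV x).
  rewrite /bonus /pass_near !source_rot !source_rotV source_flip deg_W /=.
  rewrite {2}/tdeg target_flat_rotV // permKV -/(tdeg x).
  by case/andP: deg_u => -> _ /=; lia.
Qed.

(** At a 5-vertex, shares of at least 40 cover the deficit even after relaying. Otherwise they are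
    at least 35, nothing is relayed, and [short5_bonus] supplies the missing 5. *)
Lemma vertex_charge x : (forall v : G, deg v = 5 \/ 8 <= deg v) ->
  240 + \sum_(y | fconnect s x y) outgoing y <=
  \sum_(y | fconnect s x y) (40 + incoming y).
Proof.
move=> deg_dich.
have cst k : \sum_(y | fconnect s x y) k = deg (source x) * k.
  by rewrite -order_rot; apply: sum_nat_const.
have split_sum (F H : dart G -> nat) : \sum_(y | fconnect s x y) (F y + H y) =
    \sum_(y | fconnect s x y) F y + \sum_(y | fconnect s x y) H y.
  by rewrite big_split.
rewrite split_sum cst.
have src y : fconnect s x y -> source y = source x.
  by rewrite rotationP => /eqP.
case: (deg_dich (source x)) => [deg5|deg8]; last first.
  apply: leq_trans (_ : 240 + deg (source x) * share (deg (source x)) <= _).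
    rewrite leq_add2l -cst; apply: leq_sum => y cxy.
    by rewrite -(src y cxy) outgoing_major // (src y cxy).
  by apply: leq_trans (share_afford deg8) (leq_addr _ _).
rewrite deg5 [X in _ <= _ + X](eq_bigr (fun y => share (tdeg y) + bonus y)).
  2: by move=> y /src sy; rewrite /incoming /give /tdeg target_flip sy deg5.
rewrite split_sum.
have := outgoing_five deg5; cbv zeta.
case: (leqP 40 (\sum_(y | fconnect s x y) share (tdeg y))) => [|short]; first by lia.
have : exists2 e, source e = source x & 5 <= bonus e.
  move: short; rewrite sum_rotation5 // => /(heavy5_cases (heavy deg5)).
  have bonus_at y : source y = source x ->
      short5 (tdeg y) (tdeg (s y)) (tdeg (s (s y))) (tdeg (s (s (s y))))
             (tdeg (s (s (s (s y))))) ->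
      exists2 e, source e = source x & 5 <= bonus e.
    by move=> sy /short5_bonus; rewrite sy; apply.
  have r5 := iter5_rot deg5.
  case/orP; first exact: bonus_at.
  case/or4P => sh.
  - by apply: (bonus_at (s x)); rewrite ?source_rot ?r5.
  - by apply: (bonus_at (s (s x))); rewrite ?source_rot ?r5.
  - by apply: (bonus_at (s (s (s x)))); rewrite ?source_rot ?r5.
  - by apply: (bonus_at (s (s (s (s x))))); rewrite ?source_rot ?r5.
case=> e se bonus_e; have : 5 <= \sum_(y | fconnect s x y) bonus y.
  by rewrite (bigD1 e) ?rotationP ?se //=; apply: leq_trans bonus_e (leq_addr _ _).
have := heavy5_share (heavy deg5).
rewrite -(@sum_rotation5 _ _ (fun y => share (tdeg y))) //; lia.
Qed.

End Discharging.

(** * From stars to degree patterns, and the contradiction with Euler's formula *)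

Lemma sum_nbh5 (G : plane_graph) (x : dart G) (F : G -> nat) :
    deg (source x) = 5 ->
  \sum_(u in nbh (source x)) F u =
  F (target x) + F (target (rotation G x)) +
  F (target (rotation G (rotation G x))) +
  F (target (rotation G (rotation G (rotation G x)))) +
  F (target (rotation G (rotation G (rotation G (rotation G x))))).
Proof.
move=> deg5; rewrite -sum_darts_at -(sum_rotation5 (fun d => F (target d)) deg5).
by apply: eq_bigl => d; rewrite rotationP eq_sym.
Qed.

Lemma weight_star (G : sgraph) (v : G) :
  weight (v |: nbh v) = deg v + \sum_(u in nbh v) deg u.
Proof. by rewrite /weight big_setU1 // inE adj_irr. Qed.

(** With at most one neighbor of degree at least 8, the other four would be consecutive 5-vertices,
    which is the forbidden star. *)
Lemma heavy_star (G : plane_graph) (x : dart G) :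
    (forall v : G, deg v = 5 \/ 8 <= deg v) ->
    ~ has_star G (Some 5) (Some 5) (Some 5) (Some 5) None ->
    deg (source x) = 5 ->
    44 < weight (source x |: nbh (source x)) \/
    15 < height (source x |: nbh (source x)) ->
  heavy5 (tdeg x) (tdeg (rotation G x)) (tdeg (rotation G (rotation G x)))
         (tdeg (rotation G (rotation G (rotation G x))))
         (tdeg (rotation G (rotation G (rotation G (rotation G x))))).
Proof.
move=> deg_dich nostar deg5 wh; set s := rotation G.
have r5 := iter5_rot deg5.
have star y : source y = source x -> ~ [/\ tdeg y = 5, tdeg (s y) = 5,
    tdeg (s (s y)) = 5 & tdeg (s (s (s y))) = 5].
  move=> sy [y0 y1 y2 y3]; apply: nostar; exists (source x).
  exists (target y), (target (s y)), (target (s (s y))), (target (s (s (s y)))).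
  exists (target (s (s (s (s y))))); split.
    by split=> //; exists y => //; left.
  by rewrite /le_bound -!/(tdeg _) y0 y1 y2 y3.
have s0 := star x erefl; have s1 := star (s x); have s2 := star (s (s x)).
have s3 := star (s (s (s x))); have s4 := star (s (s (s (s x)))).
rewrite !source_rot r5 in s1 s2 s3 s4.
move: (s1 erefl) (s2 erefl) (s3 erefl) (s4 erefl) => {}s1 {}s2 {}s3 {}s4.
split; first by split; apply: deg_dich.
  move: (deg_dich (target x)) (deg_dich (target (s x))) s0 s1 s2 s3 s4.
  move: (deg_dich (target (s (s x)))) (deg_dich (target (s (s (s x))))).
  move: (deg_dich (target (s (s (s (s x)))))).
  rewrite -!/(tdeg _).
  do 5 (case=> [->|->]); rewrite ?add1n //; do 5 (move=> ?);
    match goal with H : ~ _ |- _ => by case: H end.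
case: wh => [|high].
  by rewrite weight_star deg5 (sum_nbh5 (@deg G) deg5) -/s -!/(tdeg _); lia.
case: (posnP (\sum_(u in nbh (source x)) (15 < deg u))) => [/eqP|].
  rewrite sum_nat_eq0 => /forall_inP low; move: high; rewrite ltnNge => /negP[].
  apply/bigmax_leqP => u; rewrite !inE => /predU1P[->|adj_u]; first by rewrite deg5.
  by have := low u; rewrite inE adj_u => /(_ isT); rewrite eqb0 -leqNgt.
by rewrite (sum_nbh5 (fun u => nat_of_bool (15 < deg u)) deg5) -/s -!/(tdeg _); lia.
Qed.

Lemma dart_link_connect_sym (G : sgraph) (s : {perm dart G}) :
  fingraph.connect_sym (dart_link s).
Proof.
have sub : subrel (fun d e => dart_link s e d) (connect (dart_link s)).
  move=> d e /orP[/eqP <-|/eqP <-].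
    by apply: connect1; apply/orP; left; rewrite flipK.
  have : fconnect s (s e) e by rewrite fconnect_sym ?fconnect1 //; apply: perm_inj.
  by apply: connect_sub => a b /eqP <-; apply: connect1; apply/orP; right.
have symP d e : connect (dart_link s) d e -> connect (dart_link s) e d.
  by rewrite connect_rev => /(connect_sub sub).
by move=> d e; apply/idP/idP => /symP.
Qed.

Theorem theorem15 (G : plane_graph)
    (hmin : min_degree G 5)
    (hstar : ~ has_star G (Some 5) (Some 5) (Some 5) (Some 5) None)
    (h6 : forall v : G, deg v <> 6)
    (h7 : forall v : G, deg v <> 7) :
  exists H : {set G}, [/\ minor5_star H, weight H <= 44 & height H <= 15].
Proof.
case: hmin => deg_ge5 [v0 deg_v0].
have deg_dich (v : G) : deg v = 5 \/ 8 <= deg v.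
  by have := deg_ge5 v; have := h6 v; have := h7 v; lia.
case: (boolP [exists v : G, [&& deg v == 5, weight (v |: nbh v) <= 44
                               & height (v |: nbh v) <= 15]]).
  by case/existsP=> v /and3P[/eqP deg_v wv hv]; exists (v |: nbh v); split=> //; exists v.
move/existsPn=> nolight; exfalso.
have heavy (x : dart G) : deg (source x) = 5 ->
  heavy5 (tdeg x) (tdeg (rotation G x)) (tdeg (rotation G (rotation G x)))
         (tdeg (rotation G (rotation G (rotation G x))))
         (tdeg (rotation G (rotation G (rotation G (rotation G x))))).
  move=> deg5; apply: heavy_star => //.
  have := nolight (source x); rewrite deg5 eqxx /= negb_and -!ltnNge.
  by case/orP; [left | right].
have vertices := @sum_fcard _ (rotation G) 240 (@outgoing G)
  (fun y => 40 + incoming y) perm_inj (fun x => vertex_charge heavy x deg_dich).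
have split_sum (F H : dart G -> nat) :
  \sum_d (F d + H d) = \sum_d F d + \sum_d H d by rewrite big_split.
have faces := face_weight deg_ge5.
have edges := double_fcard_flip G.
have euler := rotation_genus0 G; rewrite /genus0 in euler.
have comps : 0 < n_comp (dart_link (rotation G)) (dart G).
  have [u adj_u] : exists u, u \in nbh v0.
    by apply/set0Pn; rewrite -cards_eq0 -/(deg v0) deg_v0.
  rewrite inE in adj_u; pose d : dart G := exist _ (v0, u) adj_u.
  apply/card_gt0P; exists (root (dart_link (rotation G)) d).
  rewrite !inE andbT; apply/roots_root/dart_link_connect_sym.
have spills : \sum_(d : dart G) (if tri d then 80 else 60) + 2 * \sum_(d : dart G) spill d
    = #|dart G| * 80.
  have -> : \sum_(d : dart G) (if tri d then 80 else 60) + 2 * \sum_(d : dart G) spill d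
      = \sum_(d : dart G) ((if tri d then 80 else 60) + (spill d + spill d)).
    by rewrite !split_sum mul2n addnn.
  rewrite -sum_nat_const; apply: eq_bigr => d _; rewrite /spill; by case: ifP.
have base : \sum_(d : dart G) 40 = #|dart G| * 40 by rewrite -sum_nat_const.
(* Outgoing charge and spills cancel, leaving [240 (V + E + F) <= 240 #darts], whereas Euler's
   formula has the extra [2 C] with [C > 0]. *)
move: vertices faces edges euler comps spills.
rewrite split_sum base sum_incoming; lia.
Qed.
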